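(* Let $n$ be a nonnegative integer and let $a,c$ be complex numbers such that no lower parameter of the series below is a nonpositive integer and all denominators below are nonzero. Then $$\frac{(c-a+1)_n}{(c)_n}={}_6F_5\left[\begin{matrix}1+\frac{c-a}{3},\ -\frac n2,\ \frac{1-n}{2},\ \frac{1-a}{2},\ \frac{2-a}{2},\ c-a\\ \frac12,\ \frac{c-a}{3},\ c,\ 1-c-n,\ c+1-a+n\end{matrix};-4\right]-\frac{n(1-a)}{1-c-n}\;{}_5F_4\left[\begin{matrix}\frac{1-n}{2},\ \frac{2-n}{2},\ \frac{2-a}{2},\ \frac{3-a}{2},\ 1+c-a\\ \frac32,\ c,\ 2-c-n,\ c+1-a+n\end{matrix};-4\right].$$
   Context: $(x)_0=1$ and $(x)_n=x(x+1)\cdots(x+n-1)$ for $n\ge1$. The generalized hypergeometric series is ${}_pF_q\left[\begin{matrix}a_1,\dots,a_p\\ b_1,\dots,b_q\end{matrix};z\right]=\sum_{k\ge0}\frac{(a_1)_k\cdots(a_p)_k}{(b_1)_k\cdots(b_q)_k}\frac{z^k}{k!}$, with lower parameters $b_j\in\mathbb{C}\setminus\mathbb{Z}_{\le0}$. The series involved terminate; a term whose coefficient vanishes because of the factor $n$ (when $n=0$) is read as $0$. *)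

(* Defs.v *)
From mathcomp Require Import all_boot all_order all_algebra.
From mathcomp Require Export complex.
From mathcomp Require Import all_classical all_reals all_analysis.

Set Implicit Arguments.
Unset Strict Implicit.
Unset Printing Implicit Defensive.

Import Order.TTheory GRing.Theory Num.Theory.
Import numFieldNormedType.Exports.

Local Open Scope ring_scope.
Local Open Scope complex_scope.

Definition pochhammer (R : realType) (x : R[i]) (n : nat) : R[i] :=
  \prod_(j < n) (x + j%:R).

Definition hypergeom_term (R : realType) (upper lower : seq R[i]) (z : R[i])
    (k : nat) : R[i] :=
  (\prod_(a <- upper) pochhammer a k) / (\prod_(b <- lower) pochhammer b k)
  * (z ^+ k / k`!%:R).

(* The regular module [R[i]^o] carries the topology of the modulus.  The limit
   is total: on a divergent series it is an unspecified value. *)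
Definition hypergeom (R : realType) (upper lower : seq R[i]) (z : R[i]) : R[i] :=
  limn (series (hypergeom_term upper lower z : nat -> R[i]^o)).

Definition admissible_lower (R : realType) (lower : seq R[i]) : Prop :=
  forall b, b \in lower -> forall m : nat, b != - m%:R.

(* Main.v *)
Require Import Defs.
From mathcomp Require Import all_boot all_order all_algebra.
From mathcomp Require Import complex.
From mathcomp Require Import all_classical all_reals all_analysis.
From mathcomp Require Import ring zify.

(** Write b = c - a.  Duplicating the half-integer Pochhammer symbols and
    reversing (1 - c - n)_k turns the two series, multiplied by (c)_n, into the
    even- and odd-indexed parts of one finite sum:
      (b + 1)_n =
        sum_k C(n,2k) (1-a)_2k [(b+1)_k + 2k (b+1)_(k-1)] (c)_(n-k)
                / ((c)_k (b+1+n)_k)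
      + sum_k C(n,2k+1) (1-a)_(2k+1) (b+1)_k (c)_(n-1-k)
                / ((c)_k (b+1+n)_k).

    This is proved by induction on n, but not at fixed a: the parameters held
    fixed are c and e = b + 1 + n, so that 1 - a = e - c - n and b + 1 = e - n.
    The denominators (c)_k (e)_k are then the same at every stage of the
    induction and never vanish, whereas at fixed a the numbers b + 1 + m with
    m < n could be nonpositive integers.  The left-hand side becomes
    (e - n)_n = (e - 1) ... (e - n), so the sum T(n) has to satisfy
      T(n+1) = (e - n - 1) T(n).
    The difference of the two sides telescopes.  If t(n,j) denotes the j-th
    term, with even and odd indices interleaved, and h is the integer part of
    j / 2, the sum of t(n+1,i) - (e-n-1) t(n,i) over i <= j is
      C(n,j) (d)_j (e-n-1)_h (c)_(n-j+h) (n+1-j-d) / ((c)_h (e)_h),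
    where d = e - c - n; it vanishes for j > n.  Lemmas odd_step and even_step
    check this closed form one index at a time, sum_terms draws the conclusion,
    and even_term_hypergeom and odd_term_hypergeom translate the hypergeometric
    terms. *)

Set Implicit Arguments.
Unset Strict Implicit.

Import Order.TTheory GRing.Theory Num.Theory.
Local Open Scope ring_scope.
Local Open Scope complex_scope.

(** * Pochhammer symbols *)

Section Pochhammer.
Variable R : realType.
Implicit Types (x c : R[i]) (n k : nat).

Lemma pochhammer0 x : pochhammer x 0 = 1.
Proof. by rewrite /pochhammer big_ord0. Qed.

Lemma pochhammerSr x n : pochhammer x n.+1 = pochhammer x n * (x + n%:R).
Proof. by rewrite /pochhammer big_ord_recr. Qed.

Lemma pochhammerSl x n : pochhammer x n.+1 = x * pochhammer (x + 1) n.
Proof.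
rewrite /pochhammer big_ord_recl /= addr0; congr (_ * _).
by apply: eq_bigr => i _; rewrite /bump /= add1n -natr1; ring.
Qed.

Lemma pochhammer_neq0 x n : (forall m, x != - m%:R) -> pochhammer x n != 0.
Proof.
move=> hx; apply/prodf_neq0 => j _; rewrite -[_ + _]opprK oppr_eq0 opprD.
by rewrite addrC subr_eq0 eq_sym.
Qed.

Lemma pochhammer1 n : pochhammer (1 : R[i]) n = n`!%:R.
Proof.
elim: n => [|n IH]; first by rewrite pochhammer0.
by rewrite pochhammerSr IH factS natrM -natr1; ring.
Qed.

Lemma pochhammer_double x k :
  pochhammer (x / 2) k * pochhammer ((x + 1) / 2) k * 4 ^+ k
  = pochhammer x (k.*2).
Proof.
elim: k => [|k IH]; first by rewrite !pochhammer0 expr0 !mulr1.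
rewrite doubleS !pochhammerSr -IH exprS -!natr1 -mul2n natrM; field.
by rewrite ?pnatr_eq0.
Qed.

(** The factors of (1 - c - n)_k are the opposites of the last k factors of
    (c)_n, which (c)_(n-k) lacks. *)
Lemma pochhammer_reflect c n k : (k <= n)%N ->
  pochhammer (1 - c - n%:R) k * pochhammer c (n - k) = (-1) ^+ k * pochhammer c n.
Proof.
elim: k => [|k IH] kn; first by rewrite pochhammer0 subn0 expr0.
rewrite pochhammerSr exprS -mulrA -[RHS]mulrA -(IH (ltnW kn)).
have -> : (n - k = (n - k.+1).+1)%N by lia.
by rewrite pochhammerSr natrB // -natr1; ring.
Qed.

Lemma pochhammer_opp_nat n k :
  pochhammer (- n%:R : R[i]) k = (-1) ^+ k * ('C(n, k) * k`!)%:R.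
Proof.
rewrite bin_ffact; elim: k => [|k IH].
  by rewrite pochhammer0 expr0 ffactn0 mulr1.
rewrite pochhammerSr IH ffactnSr exprS natrM.
have [kn|nk] := leqP k n; first by rewrite natrB //; ring.
by rewrite ffact_small // !(mul0r, mulr0).
Qed.

End Pochhammer.

(** * The interleaved finite sum *)

Section Summation.
Variable R : realType.
Variables e c : R[i].

(** The bracket is (e-n-1)_k (e-n-1+3k) / (e-n-1), the contribution of
    (b)_k (1 + b/3)_k / (b/3)_k at b = e - n - 1.  In this form it needs no
    division by e - n - 1, which can vanish during the induction; for k = 0 the
    truncated predecessor is harmless, its coefficient being 0. *)
Definition even_term n k : R[i] :=
  'C(n, k.*2)%:R * pochhammer (e - c - n%:R) k.*2
  * (pochhammer (e - n%:R) k + k.*2%:R * pochhammer (e - n%:R) k.-1)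
  * pochhammer c (n - k) / (pochhammer c k * pochhammer e k).

Definition odd_term n k : R[i] :=
  'C(n, k.*2.+1)%:R * pochhammer (e - c - n%:R) k.*2.+1
  * pochhammer (e - n%:R) k
  * pochhammer c (n - k.+1) / (pochhammer c k * pochhammer e k).

(** The partial sum of t(n+1,i) - (e-n-1) t(n,i) over i <= 2k. *)
Definition even_certificate n k : R[i] :=
  'C(n, k.*2)%:R * pochhammer (e - c - n%:R) k.*2
  * pochhammer (e - n.+1%:R) k * pochhammer c (n - k)
  * (n.+1%:R - k.*2%:R - (e - c - n%:R)) / (pochhammer c k * pochhammer e k).

(** The partial sum of t(n+1,i) - (e-n-1) t(n,i) over i <= 2k+1. *)
Definition odd_certificate n k : R[i] :=
  'C(n, k.*2.+1)%:R * pochhammer (e - c - n%:R) k.*2.+1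
  * pochhammer (e - n.+1%:R) k * pochhammer c (n - k.+1)
  * (n%:R - k.*2%:R - (e - c - n%:R)) / (pochhammer c k * pochhammer e k).

Hypothesis c_ok : forall m : nat, c != - m%:R.
Hypothesis e_ok : forall m : nat, e != - m%:R.

(** Absorbing the factor e - n - 1 of the recurrence brings the terms at n and
    at n + 1 to the common symbol (e - n - 1)_k. *)
Lemma pochhammer_shift n k :
  (e - n.+1%:R) * pochhammer (e - n%:R) k
  = pochhammer (e - n.+1%:R) k * (e - n.+1%:R + k%:R).
Proof.
rewrite -pochhammerSr pochhammerSl; congr (_ * pochhammer _ _).
by rewrite -natr1; ring.
Qed.

Lemma bin_ratio n j :
  'C(n, j.+1)%:R * j.+1%:R = (n%:R - j%:R) * 'C(n, j)%:R :> R[i].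
Proof.
have [jn|nj] := leqP j n; first by rewrite -natrB // -!natrM mulnC mul_bin_left.
by rewrite !bin_small ?(ltnW nj) // 1?ltnW // mul0r mulr0.
Qed.

(** Once all symbols are expressed through those occurring in
    [odd_certificate], this reduces to
      (2k+1) (n+1-2k-d) + (n+1) (d-1) = (n-2k) (d+2k),  d = e - c - n. *)
Lemma odd_step n k :
  even_certificate n k + (odd_term n.+1 k - (e - n.+1%:R) * odd_term n k)
  = odd_certificate n k.
Proof.
have c0 := pochhammer_neq0 k c_ok; have e0 := pochhammer_neq0 k e_ok.
have -> : (e - n.+1%:R) * odd_term n k
    = 'C(n, k.*2.+1)%:R * pochhammer (e - c - n%:R) k.*2.+1
      * (pochhammer (e - n.+1%:R) k * (e - n.+1%:R + k%:R))
      * pochhammer c (n - k.+1) / (pochhammer c k * pochhammer e k).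
  by rewrite -pochhammer_shift /odd_term; field; rewrite c0 e0.
rewrite /even_certificate /odd_term /odd_certificate.
have [kn|nk] := leqP k.*2 n; last first.
  by rewrite !bin_small ?ltnS // 1?ltnW // !mul0r subrr addr0.
have -> : e - c - n%:R = e - c - n.+1%:R + 1 by rewrite -natr1; ring.
rewrite [pochhammer (e - c - n.+1%:R) _]pochhammerSl.
rewrite binS natrD subSS !pochhammerSr.
(* For n = 2k the odd binomial vanishes and cannot serve as common factor. *)
have [nk|kn'] := leqP n k.*2.
  have -> : n = k.*2 by lia.
  rewrite binn bin_small // -!natr1; field; by rewrite c0 e0.
have nz2 : n%:R - k.*2%:R != 0 :> R[i] by rewrite subr_eq0 eqr_nat; lia.
have -> : 'C(n, k.*2)%:R
    = 'C(n, k.*2.+1)%:R * k.*2.+1%:R / (n%:R - k.*2%:R) :> R[i].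
  by rewrite bin_ratio mulrC mulKf.
have -> : (n - k = (n - k.+1).+1)%N by lia.
rewrite pochhammerSr natrB; last by lia.
move: nz2; rewrite -!natr1 -mul2n natrM => nz2.
by field; rewrite c0 e0 nz2.
Qed.

(** The same computation with the next binomial coefficient; here the
    denominators (c)_k (e)_k also pass from k to k + 1. *)
Lemma even_step n k :
  odd_certificate n k
    + (even_term n.+1 k.+1 - (e - n.+1%:R) * even_term n k.+1)
  = even_certificate n k.+1.
Proof.
have c0 := pochhammer_neq0 k c_ok; have e0 := pochhammer_neq0 k e_ok.
have c1 : c + k%:R != 0 by rewrite addr_eq0.
have e1 : e + k%:R != 0 by rewrite addr_eq0.
have -> : (e - n.+1%:R) * even_term n k.+1
    = 'C(n, k.+1.*2)%:R * pochhammer (e - c - n%:R) k.+1.*2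
      * (pochhammer (e - n.+1%:R) k * (e - n.+1%:R + k%:R))
      * (e - n%:R + k%:R + k.+1.*2%:R)
      * pochhammer c (n - k.+1) / (pochhammer c k.+1 * pochhammer e k.+1).
  rewrite -pochhammer_shift /even_term [k.+1.-1]/= !(pochhammerSr _ k).
  by field; rewrite c0 e0 c1 e1.
rewrite /even_certificate /even_term /odd_certificate doubleS [k.+1.-1]/=.
have [kn|nk] := leqP k.*2.+1 n; last first.
  by rewrite !bin_small ?ltnS // 1?ltnW // !mul0r subrr addr0.
have -> : e - c - n%:R = e - c - n.+1%:R + 1 by rewrite -natr1; ring.
rewrite [pochhammer (e - c - n.+1%:R) _]pochhammerSl.
rewrite binS natrD subSS !pochhammerSr.
(* As in the odd step, n = 2k + 1 leaves no common binomial factor. *)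
have [nk|kn'] := leqP n k.*2.+1.
  have -> : n = k.*2.+1 by lia.
  have -> : (k.*2.+1 - k.+1 = k)%N by lia.
  have -> : (k.*2.+1 - k = k.+1)%N by lia.
  rewrite binn bin_small // !pochhammerSr.
  rewrite -!natr1 -mul2n natrM; field; by rewrite c0 e0 c1 e1.
have nz2 : n%:R - k.*2.+1%:R != 0 :> R[i] by rewrite subr_eq0 eqr_nat; lia.
have -> : 'C(n, k.*2.+1)%:R
    = 'C(n, k.*2.+2)%:R * k.*2.+2%:R / (n%:R - k.*2.+1%:R) :> R[i].
  by rewrite bin_ratio mulrC mulKf.
have -> : (n - k = (n - k.+1).+1)%N by lia.
have -> : (n - k.+1 = (n - k.+2).+1)%N by lia.
rewrite !pochhammerSr -[(n - k.+2).+1%:R]natr1 natrB; last by lia.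
move: nz2; rewrite -!natr1 -mul2n natrM => nz2.
by field; rewrite c0 e0 c1 e1 nz2.
Qed.

Lemma base_step n :
  even_term n.+1 0 - (e - n.+1%:R) * even_term n 0 = even_certificate n 0.
Proof.
rewrite /even_certificate /even_term /= double0 !bin0 !subn0 !pochhammer0.
by rewrite pochhammerSr -!natr1; field.
Qed.

Lemma sum_step n K :
  \sum_(k < K.+1) (even_term n.+1 k + odd_term n.+1 k)
  = (e - n.+1%:R) * \sum_(k < K.+1) (even_term n k + odd_term n k)
    + odd_certificate n K.
Proof.
elim: K => [|K IH].
  rewrite !big_ord_recr !big_ord0 /= !add0r -odd_step -base_step; ring.
rewrite big_ord_recr IH [in RHS]big_ord_recr /= -(odd_step n K.+1) -even_step.
ring.
Qed.

(** The bound on K puts the last certificate, of index 2K + 1, beyond n at every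
    stage of the induction, so the recurrence is homogeneous. *)
Lemma sum_terms n K : (n <= K.*2)%N ->
  \sum_(k < K.+1) (even_term n k + odd_term n k) = pochhammer (e - n%:R) n.
Proof.
elim: n => [_|n IH nK].
  rewrite big_ord_recl big1 => [|i _].
    rewrite /even_term /odd_term /= double0 bin0 !pochhammer0.
    by rewrite (_ : 'C(0, 1) = 0%N) //; field.
  by rewrite /even_term /odd_term !bin_small // !mul0r addr0.
rewrite sum_step IH 1?ltnW // /odd_certificate bin_small; last by lia.
rewrite !mul0r addr0 pochhammerSl; congr (_ * pochhammer _ _).
by rewrite -natr1; ring.
Qed.

End Summation.

(** * Translation of the two hypergeometric series *)

Section Series.
Variable R : realType.

Lemma hypergeom_finite (upper lower : seq R[i]) (z : R[i]) K :
  (forall k, (K <= k)%N -> hypergeom_term upper lower z k = 0) ->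
  hypergeom upper lower z = \sum_(k < K) hypergeom_term upper lower z k.
Proof.
move=> h; rewrite /hypergeom.
apply: (@cvg_lim (R[i]^o)%type) => //.
apply: cvg_near_cst; exists K => // m /= Km.
rewrite /series /= (big_cat_nat (n := K)) //= big_mkord.
rewrite [X in _ + X]big_nat_cond [X in _ + X]big1 ?addr0 // => k.
by rewrite andbT => /andP[/h].
Qed.

(** The two upper parameters containing n terminate the series: the right-hand
    side is 0 as soon as 2k > n. *)
Lemma pochhammer_double_nat n k :
  pochhammer (- (n%:R / 2) : R[i]) k * pochhammer ((1 - n%:R) / 2) k
  = ('C(n, k.*2) * k.*2`!)%:R / 4 ^+ k.
Proof.
have q0 : (4 : R[i]) ^+ k != 0 by rewrite expf_neq0 // pnatr_eq0.
have := pochhammer_double (- n%:R : R[i]) k.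
rewrite pochhammer_opp_nat -signr_odd odd_double expr0 mul1r => <-.
by rewrite mulfK // mulNr [- _ + 1]addrC.
Qed.

Lemma pochhammer_half k :
  pochhammer (1 / 2 : R[i]) k * k`!%:R = k.*2`!%:R / 4 ^+ k.
Proof.
have q0 : (4 : R[i]) ^+ k != 0 by rewrite expf_neq0 // pnatr_eq0.
rewrite -!pochhammer1 -pochhammer_double mulfK //; congr (_ * pochhammer _ _).
by field.
Qed.

Lemma pochhammer_three_halves k :
  pochhammer (3 / 2 : R[i]) k * k`!%:R = k.*2.+1`!%:R / 4 ^+ k.
Proof.
have q0 : (4 : R[i]) ^+ k != 0 by rewrite expf_neq0 // pnatr_eq0.
have -> : k.*2.+1`!%:R = pochhammer (2 : R[i]) k.*2.
  by rewrite -pochhammer1 pochhammerSl mul1r.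
rewrite -pochhammer_double mulfK // mulrC -pochhammer1.
by congr (pochhammer _ _ * pochhammer _ _); field.
Qed.

(** The quotient (1 + b/3)_k / (b/3)_k is (b + 3k) / b, and
    (b)_k = b (b+1)_(k-1); the factor b + 3k is then split as (b + k) + 2k. *)
Lemma pochhammer_well_poised (b : R[i]) k : b != 0 ->
  pochhammer (1 + b / 3) k * pochhammer b k
  = pochhammer (b / 3) k
    * (pochhammer (b + 1) k + k.*2%:R * pochhammer (b + 1) k.-1).
Proof.
move=> b0; apply: (mulfI b0).
have three0 : (3 : R[i]) != 0 by rewrite pnatr_eq0.
have -> : b * (pochhammer (1 + b / 3) k * pochhammer b k)
    = 3 * (b / 3 * pochhammer (b / 3 + 1) k) * pochhammer b k.
  by rewrite [1 + _]addrC; field.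
rewrite -pochhammerSl pochhammerSr.
case: k => [|k]; first by rewrite !pochhammer0 /= double0; field.
rewrite [pochhammer b _]pochhammerSl /= !pochhammerSr.
by rewrite -mul2n natrM -!natr1; field.
Qed.

(** The powers of 4 from the duplications cancel that of the argument - 4, and
    its sign cancels the sign of the reflected symbol (1 - c - n)_k. *)
Lemma even_term_hypergeom n k (a c : R[i]) :
  admissible_lower [:: 1 / 2; (c - a) / 3; c; 1 - c - n%:R; c + 1 - a + n%:R] ->
  pochhammer c n * hypergeom_term
      [:: 1 + (c - a) / 3; - (n%:R / 2); (1 - n%:R) / 2; (1 - a) / 2;
          (2 - a) / 2; c - a]
      [:: 1 / 2; (c - a) / 3; c; 1 - c - n%:R; c + 1 - a + n%:R]
      (- 4) k
  = even_term (c + 1 - a + n%:R) c n k.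
Proof.
move=> adm; have low x xL := pochhammer_neq0 k (adm x xL).
have h0 := low (1 / 2) (mem_head _ _).
have t0 : pochhammer ((c - a) / 3) k != 0 by apply: low; rewrite !inE eqxx ?orbT.
have c0 : pochhammer c k != 0 by apply: low; rewrite !inE eqxx ?orbT.
have r0 : pochhammer (1 - c - n%:R) k != 0 by apply: low; rewrite !inE eqxx ?orbT.
have e0 : pochhammer (c + 1 - a + n%:R) k != 0.
  by apply: low; rewrite !inE eqxx ?orbT.
have ck0 : pochhammer c (n - k) != 0.
  by apply: pochhammer_neq0; apply: adm; rewrite !inE eqxx ?orbT.
have b0 : c - a != 0.
  have := adm ((c - a) / 3); rewrite !inE eqxx ?orbT => /(_ isT 0%N).
  by rewrite oppr0; apply: contra_neq => ->; rewrite mul0r.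
have q0 : (4 : R[i]) ^+ k != 0 by rewrite expf_neq0 // pnatr_eq0.
have f0 : k`!%:R != 0 :> R[i] by rewrite pnatr_eq0 -lt0n fact_gt0.
have ff0 : k.*2`!%:R != 0 :> R[i] by rewrite pnatr_eq0 -lt0n fact_gt0.
have s0 : (-1 : R[i]) ^+ k != 0 by rewrite signr_eq0.
have num_a : pochhammer ((1 - a) / 2) k * pochhammer ((2 - a) / 2) k
    = pochhammer (1 - a) k.*2 / 4 ^+ k.
  rewrite -pochhammer_double mulfK //; congr (_ * pochhammer _ _).
  by congr (_ / _); ring.
rewrite /hypergeom_term !big_cons !big_nil !mulr1.
rewrite -[- 4]mulN1r exprMn.
transitivity (
  (pochhammer (1 + (c - a) / 3) k * pochhammer (c - a) k)
  * (pochhammer (- (n%:R / 2)) k * pochhammer ((1 - n%:R) / 2) k)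
  * (pochhammer ((1 - a) / 2) k * pochhammer ((2 - a) / 2) k)
  / (pochhammer (1 / 2) k * k`!%:R) / pochhammer ((c - a) / 3) k
  / (pochhammer c k * pochhammer (c + 1 - a + n%:R) k)
  * (4 ^+ k * (-1) ^+ k * pochhammer c n / pochhammer (1 - c - n%:R) k)).
  by field; rewrite h0 t0 c0 r0 e0 f0.
rewrite pochhammer_well_poised // pochhammer_double_nat num_a pochhammer_half.
rewrite /even_term.
have -> : c + 1 - a + n%:R - n%:R = c - a + 1 by ring.
have -> : c + 1 - a + n%:R - c - n%:R = 1 - a by ring.
have [kn|nk] := leqP k.*2 n; last by rewrite bin_small // !(mul0r, mulr0).
have -> : pochhammer (1 - c - n%:R) k
    = (-1) ^+ k * pochhammer c n / pochhammer c (n - k).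
  by rewrite -pochhammer_reflect ?mulfK //; lia.
have cn0 : pochhammer c n != 0.
  by apply: pochhammer_neq0; apply: adm; rewrite !inE eqxx ?orbT.
by rewrite natrM; field; rewrite q0 ff0 t0 c0 e0 s0 cn0 ck0.
Qed.

(** Stated for n + 1, so that the upper parameters become - n/2 and (1 - n)/2
    and the lower parameter 2 - c - (n + 1) becomes 1 - c - n.  The prefactor
    supplies the factors n + 1 of the binomial and 1 - a of (1-a)_(2k+1), and
    its denominator -(c + n) reduces (c)_(n+1) to (c)_n. *)
Lemma odd_term_hypergeom n k (a c : R[i]) :
  admissible_lower [:: 3 / 2; c; 2 - c - n.+1%:R; c + 1 - a + n.+1%:R] ->
  1 - c - n.+1%:R != 0 ->
  pochhammer c n.+1 * (n.+1%:R * (1 - a) / (1 - c - n.+1%:R) * hypergeom_term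
        [:: (1 - n.+1%:R) / 2; (2 - n.+1%:R) / 2; (2 - a) / 2; (3 - a) / 2;
            1 + c - a]
        [:: 3 / 2; c; 2 - c - n.+1%:R; c + 1 - a + n.+1%:R]
        (- 4) k)
  = - odd_term (c + 1 - a + n.+1%:R) c n.+1 k.
Proof.
move=> adm; rewrite /odd_term /hypergeom_term !big_cons !big_nil !mulr1.
have -> : c + 1 - a + n.+1%:R - n.+1%:R = c - a + 1 by ring.
have -> : c + 1 - a + n.+1%:R - c - n.+1%:R = 1 - a by ring.
have low x xL := pochhammer_neq0 k (adm x xL).
have h0 := low (3 / 2) (mem_head _ _).
have c0 : pochhammer c k != 0 by apply: low; rewrite !inE eqxx ?orbT.
have r0 : pochhammer (2 - c - n.+1%:R) k != 0.
  by apply: low; rewrite !inE eqxx ?orbT.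
have e0 : pochhammer (c + 1 - a + n.+1%:R) k != 0.
  by apply: low; rewrite !inE eqxx ?orbT.
have c_ok m : pochhammer c m != 0.
  by apply: pochhammer_neq0; apply: adm; rewrite !inE eqxx ?orbT.
move: r0; have -> : 2 - c - n.+1%:R = 1 - c - n%:R by rewrite -natr1; ring.
have -> : 1 - c - n.+1%:R = - (c + n%:R) by rewrite -natr1; ring.
have -> : (1 - n.+1%:R) / 2 = - (n%:R / 2) :> R[i].
  by rewrite -natr1; field.
have -> : (2 - n.+1%:R) / 2 = (1 - n%:R) / 2 :> R[i].
  by rewrite -natr1; congr (_ / _); ring.
rewrite oppr_eq0 => r0 d0.
have q0 : (4 : R[i]) ^+ k != 0 by rewrite expf_neq0 // pnatr_eq0.
have f0 : k`!%:R != 0 :> R[i] by rewrite pnatr_eq0 -lt0n fact_gt0.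
have ff0 : k.*2`!%:R != 0 :> R[i] by rewrite pnatr_eq0 -lt0n fact_gt0.
have j0 : k.*2.+1%:R != 0 :> R[i] by rewrite pnatr_eq0.
have s0 : (-1 : R[i]) ^+ k != 0 by rewrite signr_eq0.
have num_a : pochhammer ((2 - a) / 2) k * pochhammer ((3 - a) / 2) k
    = pochhammer (2 - a) k.*2 / 4 ^+ k.
  rewrite -pochhammer_double mulfK //; congr (_ * pochhammer _ _).
  by congr (_ / _); ring.
rewrite -[- 4]mulN1r exprMn.
transitivity (
  - (n.+1%:R * (pochhammer (- (n%:R / 2)) k * pochhammer ((1 - n%:R) / 2) k))
  * ((1 - a) * (pochhammer ((2 - a) / 2) k * pochhammer ((3 - a) / 2) k))
  * pochhammer (1 + c - a) k
  / (pochhammer (3 / 2) k * k`!%:R)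
  / (pochhammer c k * pochhammer (c + 1 - a + n.+1%:R) k)
  * (4 ^+ k * (-1) ^+ k * pochhammer c n.+1 / (c + n%:R)
     / pochhammer (1 - c - n%:R) k)).
  by field; rewrite h0 c0 r0 e0 f0 d0.
rewrite pochhammer_double_nat num_a pochhammer_three_halves.
have -> : 1 + c - a = c - a + 1 by ring.
rewrite (pochhammerSr c) (pochhammerSl (1 - a)).
have -> : 1 - a + 1 = 2 - a by ring.
have [kn|nk] := leqP k.*2 n; last first.
  by rewrite !bin_small ?ltnS // !(mul0r, mulr0) oppr0 ?mul0r.
have -> : pochhammer (1 - c - n%:R) k
    = (-1) ^+ k * pochhammer c n / pochhammer c (n - k).
  by rewrite -pochhammer_reflect ?mulfK //; lia.
have -> : 'C(n.+1, k.*2.+1)%:R = n.+1%:R * 'C(n, k.*2)%:R / k.*2.+1%:R :> R[i].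
  by rewrite -natrM mul_bin_diag natrM mulrC mulKf.
have cn0 := c_ok n; have ck0 := c_ok (n - k)%N.
rewrite factS !natrM subSS.
by field; rewrite q0 ff0 c0 e0 s0 cn0 ck0 d0 nat1r j0.
Qed.

Lemma hypergeom_term_vanish n k (upper lower : seq R[i]) z :
  - (n%:R / 2) \in upper -> (1 - n%:R) / 2 \in upper -> (n < k.*2)%N ->
  hypergeom_term upper lower z k = 0.
Proof.
move=> h1 h2 nk; have := pochhammer_double_nat n k.
rewrite bin_small // mul0n mul0r => /eqP; rewrite mulf_eq0 /hypergeom_term.
by case/orP => /eqP h; [rewrite (big_rem _ h1) | rewrite (big_rem _ h2)];
  rewrite /= h !mul0r.
Qed.

End Series.

Theorem theorem3p6 (R : realType) (n : nat) (a c : R[i])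
  (lower6F5 : admissible_lower
     [:: 1 / 2; (c - a) / 3; c; 1 - c - n%:R; c + 1 - a + n%:R])
  (lower5F4 : admissible_lower
     [:: 3 / 2; c; 2 - c - n%:R; c + 1 - a + n%:R])
  (den_lhs : pochhammer c n != 0)
  (den_coef : 1 - c - n%:R != 0) :
  pochhammer (c - a + 1) n / pochhammer c n =
    hypergeom
      [:: 1 + (c - a) / 3; - (n%:R / 2); (1 - n%:R) / 2; (1 - a) / 2;
          (2 - a) / 2; c - a]
      [:: 1 / 2; (c - a) / 3; c; 1 - c - n%:R; c + 1 - a + n%:R]
      (- 4)
    - n%:R * (1 - a) / (1 - c - n%:R) *
      hypergeom
        [:: (1 - n%:R) / 2; (2 - n%:R) / 2; (2 - a) / 2; (3 - a) / 2;
            1 + c - a]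
        [:: 3 / 2; c; 2 - c - n%:R; c + 1 - a + n%:R]
        (- 4).
Proof.
have c_ok : forall m : nat, c != - m%:R.
  by apply: lower6F5; rewrite !inE eqxx ?orbT.
have e_ok : forall m : nat, c + 1 - a + n%:R != - m%:R.
  by apply: lower6F5; rewrite !inE eqxx ?orbT.
rewrite (@hypergeom_finite _ _ _ _ n.+1); last first.
  move=> k nk; apply: (@hypergeom_term_vanish _ n); rewrite ?inE ?eqxx ?orbT //.
  by lia.
apply: (mulfI den_lhs); rewrite mulrBr mulrCA divff // mulr1 mulr_sumr.
under eq_bigr do rewrite even_term_hypergeom //.
have -> : pochhammer (c - a + 1) n
    = \sum_(k < n.+1) (even_term (c + 1 - a + n%:R) c n k
                       + odd_term (c + 1 - a + n%:R) c n k).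
  by rewrite sum_terms //; [congr (pochhammer _ _); ring | lia].
rewrite big_split /=; congr (_ + _).
(* For n = 0 the second series need not terminate, but its coefficient is 0. *)
case: n => [|n] in lower6F5 lower5F4 den_lhs den_coef c_ok e_ok *.
  rewrite !mul0r mulr0 oppr0 big_ord_recl big_ord0 addr0 /odd_term.
  by rewrite bin_small // !mul0r.
rewrite (@hypergeom_finite _ _ _ _ n.+2); last first.
  move=> k nk; apply: (@hypergeom_term_vanish _ n); last by lia.
    rewrite inE; apply/orP; left; apply/eqP.
    by rewrite -natr1; field.
  rewrite !inE; apply/orP; right; apply/orP; left; apply/eqP.
  by rewrite -natr1; congr (_ / _); ring.
rewrite !mulr_sumr -sumrN; apply: eq_bigr => k _.
by rewrite odd_term_hypergeom // opprK.
Qed.
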